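(* $a_{\{0101,0112,0120\}}(1)=1$, and for all $n\ge2$, $$a_{\{0101,0112,0120\}}(n)=\frac{1}{24}\left(n^4-6n^3+47n^2-114n+120\right).$$
   Context: An ascent in an integer sequence $s_1\cdots s_m$ is an index $j$ with $s_j<s_{j+1}$; $\mathrm{asc}$ denotes the number of ascents. An ascent sequence is a sequence $x_1\cdots x_n$ of nonnegative integers with $x_1=0$ and $x_i\le 1+\mathrm{asc}(x_1\cdots x_{i-1})$ for all $i\ge2$. The reduction $\mathrm{red}(w)$ of an integer sequence $w$ replaces the $i$-th smallest distinct letter of $w$ by $i-1$; a pattern is a reduced sequence. A sequence $x$ contains a pattern $p=p_1\cdots p_k$ if there are indices $i_1<\cdots<i_k$ with $\mathrm{red}(x_{i_1}\cdots x_{i_k})=p$; otherwise $x$ avoids $p$. For a finite set $P$ of patterns, $a_P(n)$ denotes the number of ascent sequences of length $n$ avoiding every pattern in $P$. *)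

(* Defs.v *)
From mathcomp Require Import all_boot all_order all_algebra.
Set Implicit Arguments. Unset Strict Implicit. Unset Printing Implicit Defensive.

Fixpoint asc (s : seq nat) : nat :=
  match s with
  | x :: ((y :: _) as t) => (x < y) + asc t
  | _ => 0
  end.

Definition is_ascent_seq (x : seq nat) : bool :=
  (head 1 x == 0) &&
  [forall i : 'I_(size x), (0 < i) ==> (nth 0 x i <= (asc (take i x)).+1)].

Definition red (w : seq nat) : seq nat :=
  map (fun a => index a (sort leq (undup w))) w.

Definition contains (x p : seq nat) : bool :=
  [exists m : (size x).-tuple bool, red (mask m x) == p].

Definition avoids (x p : seq nat) : bool := ~~ contains x p.

(* a_P(n): number of ascent sequences of length n avoiding all patterns in P.
   Entries of an ascent sequence of length n are at most n-1, so every such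
   sequence is an n-tuple with entries in 'I_n. *)
Definition aP (P : seq (seq nat)) (n : nat) : nat :=
  #|[set t : n.-tuple 'I_n |
      let x := map (@nat_of_ord n) t in
      is_ascent_seq x && all (avoids x) P]|.

(* Main.v *)
Require Import Defs.
From HB Require Import structures.
From mathcomp Require Import all_boot all_order all_algebra.
From mathcomp Require Import zify ring.
Import GRing.Theory.

Set Implicit Arguments. Unset Strict Implicit. Unset Printing Implicit Defensive.

(** Let [x] be an ascent sequence avoiding the three patterns, with maximum [k].
    It turns out that [x] has exactly [k] ascents, contains all letters [0..k]
    and all pairs [a < b <= k] as subsequences, so that the letters that may be
    appended to [x] are governed by very little information. Up to the value of
    [k] there are only eight kinds of such sequences:
    [0^a], [0^a 1], [0^a 1^b] with [b >= 2], [0^a 1 0^b], [0^a 1 0^b 2],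
    [0^a 1 (0^b) 2 .. k], the same with [k] repeated, and the sequences that
    can only be continued by repeating the last letter. They form the states of
    a generating tree, whose level sizes satisfy linear recurrences with
    polynomial solutions. *)

Local Open Scope nat_scope.

Definition patterns := [:: [:: 0; 1; 0; 1]; [:: 0; 1; 1; 2]; [:: 0; 1; 2; 0]].

Definition good (x : seq nat) : bool := is_ascent_seq x && all (avoids x) patterns.

(** * Occurrences of the three patterns as explicit subsequences *)

Lemma containsP (x p : seq nat) :
  reflect (exists2 w, subseq w x & red w = p) (contains x p).
Proof.
apply: (iffP existsP) => [[m /eqP <-]|[w /subseqP [m sz ->] <-]].
  by exists (mask m x) => //; apply: mask_subseq.
by have szm : size m == size x by [apply/eqP]; exists (Tuple szm).
Qed.

(** The list [sort leq (undup w)] is strictly increasing, so taking indices in it preserves and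
    reflects order. *)
Lemma red_index_ltn (w : seq nat) a b : a \in w -> b \in w ->
  (index a (sort leq (undup w)) < index b (sort leq (undup w))) = (a < b).
Proof.
move=> aw bw; set s := sort leq (undup w).
have as_ : a \in s by rewrite mem_sort mem_undup.
have bs : b \in s by rewrite mem_sort mem_undup.
have srt : sorted ltn s.
  by rewrite ltn_sorted_uniq_leq sort_uniq undup_uniq sort_sorted //; apply: leq_total.
apply/idP/idP => [lt|ab].
  by apply: (sorted_ltn_index ltn_trans srt).
case: (ltngtP (index a s) (index b s)) => // [lt|eq].
  have := sorted_ltn_index ltn_trans srt _ _ bs as_ lt; rewrite /=; lia.
have : a = b by rewrite -(nth_index 0 as_) eq nth_index.
lia.
Qed.

(** Reduction keeps all relative orders; they are spelled out in both directions so that [lia] can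
    also derive equalities of letters. *)
Lemma red4 a b c d p q r s : red [:: a; b; c; d] = [:: p; q; r; s] ->
  [/\ [/\ (a < b) = (p < q), (b < a) = (q < p), (a < c) = (p < r) & (c < a) = (r < p)],
      [/\ (a < d) = (p < s), (d < a) = (s < p), (b < c) = (q < r) & (c < b) = (r < q)]
    & [/\ (b < d) = (q < s), (d < b) = (s < q), (c < d) = (r < s) & (d < c) = (s < r)]].
Proof.
have := @red_index_ltn [:: a; b; c; d].
rewrite /red [map _ _]/=; move: (sort _ _) => t lt [<- <- <- <-].
by do !split; rewrite lt // !inE eqxx ?orbT.
Qed.

Lemma red_size4 w p q r s : red w = [:: p; q; r; s] ->
  exists a b c d, w = [:: a; b; c; d].
Proof.
move=> e; have : size w = 4 by rewrite -(size_map (fun a => index a (sort leq (undup w))) w) -/(red w) e.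
by case: w {e} => [|a [|b [|c [|d [|]]]]] // _; exists a, b, c, d.
Qed.

Lemma red_0101P w : red w = [:: 0; 1; 0; 1] <-> exists a b, a < b /\ w = [:: a; b; a; b].
Proof.
split=> [e|[a [b [ab ->]]]].
  have [a [b [c [d ew]]]] := red_size4 e; subst w.
  have [[? ? ? ?] [? ? ? ?] [? ? ? ?]] := red4 e.
  exists a, b; split; first by lia.
  by do 4 (congr cons => //; try lia).
have E1 : (a == b) = false by lia.
have U : undup [:: a; b; a; b] = [:: a; b] by rewrite /= !inE !eqxx !orbT E1.
have S : sort leq [:: a; b] = [:: a; b].
  by apply: sorted_sort => //; [exact: leq_trans | rewrite /=; lia].
by rewrite /red U S /= !eqxx E1.
Qed.

Lemma red_0112P w : red w = [:: 0; 1; 1; 2] <->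
  exists a b c, [/\ a < b, b < c & w = [:: a; b; b; c]].
Proof.
split=> [e|[a [b [c [ab bc ->]]]]].
  have [a [b [c [d ew]]]] := red_size4 e; subst w.
  have [[? ? ? ?] [? ? ? ?] [? ? ? ?]] := red4 e.
  exists a, b, d; split; [lia|lia|].
  by do 4 (congr cons => //; try lia).
have E1 : (a == b) = false by lia.
have E2 : (a == c) = false by lia.
have E3 : (b == c) = false by lia.
have U : undup [:: a; b; b; c] = [:: a; b; c] by rewrite /= !inE !eqxx E1 E2 E3.
have S : sort leq [:: a; b; c] = [:: a; b; c].
  by apply: sorted_sort => //; [exact: leq_trans | rewrite /=; lia].
by rewrite /red U S /= !eqxx E1 E2 E3.
Qed.

Lemma red_0120P w : red w = [:: 0; 1; 2; 0] <->
  exists a b c, [/\ a < b, b < c & w = [:: a; b; c; a]].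
Proof.
split=> [e|[a [b [c [ab bc ->]]]]].
  have [a [b [c [d ew]]]] := red_size4 e; subst w.
  have [[? ? ? ?] [? ? ? ?] [? ? ? ?]] := red4 e.
  exists a, b, c; split; [lia|lia|].
  by do 4 (congr cons => //; try lia).
have E1 : (a == b) = false by lia.
have E2 : (a == c) = false by lia.
have E3 : (b == c) = false by lia.
have E4 : (b == a) = false by lia.
have E5 : (c == a) = false by lia.
(* [undup] keeps last occurrences, so the result is not increasing here and its sorted form is found
   through a permutation. *)
have U : undup [:: a; b; c; a] = [:: b; c; a].
  by rewrite /= !inE !eqxx E1 E2 E3 E4 E5.
have S : sort leq [:: b; c; a] = [:: a; b; c].
  rewrite -(@sorted_sort _ leq leq_trans [:: a; b; c]); last by rewrite /=; lia.
  apply/perm_sortP; [exact: leq_total|exact: leq_trans|exact: anti_leq|].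
  by rewrite (perm_catC [:: b; c] [:: a]).
by rewrite /red U S /= !eqxx E1 E2 E3.
Qed.

(** * Appending one letter *)

Lemma subseq_rcons2 (T : eqType) (w x : seq T) c u :
  subseq (rcons w c) (rcons x u) = subseq (rcons w c) x || (c == u) && subseq w x.
Proof.
(* Reversal brings the last letters to the front, where [subseq] computes. *)
rewrite -subseq_rev -(subseq_rev (rcons w c) x) -(subseq_rev w x) !rev_rcons /=.
case: eqP => [->|_] /=; last by rewrite orbF.
apply/idP/orP => [->|[|//]]; first by right.
exact: cons_subseq.
Qed.

(* Appending [v] to [x] creates an occurrence of 0101, 0112 or 0120. *)
Definition bad (x : seq nat) (v : nat) : Prop :=
  [\/ exists2 a, a < v & subseq [:: a; v; a] x,
      exists a b, [/\ a < b, b < v & subseq [:: a; b; b] x]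
    | exists b c, [/\ v < b, b < c & subseq [:: v; b; c] x]].

(** If the letter [u] takes part in the threat to [v], it is the third letter of the pattern, so
    only a pair in [x] is needed before it. This is why profiles record pairs. *)
Lemma bad_rcons x u v : bad (rcons x u) v <->
  [\/ bad x v, u < v /\ subseq [:: u; v] x,
      u < v /\ (exists2 a, a < u & subseq [:: a; u] x)
    | exists b, [/\ v < b, b < u & subseq [:: v; b] x]].
Proof.
split.
  case=> [[a av]|[a [b [ab bv]]]|[b [c [vb bc]]]].
  - rewrite (subseq_rcons2 [:: a; v]) => /orP [s|/andP [/eqP eu s]].
      by constructor 1; constructor 1; exists a.
    by subst u; constructor 2.
  - rewrite (subseq_rcons2 [:: a; b]) => /orP [s|/andP [/eqP eu s]].
      by constructor 1; constructor 2; exists a, b.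
    by subst u; constructor 3; split => //; exists a.
  - rewrite (subseq_rcons2 [:: v; b]) => /orP [s|/andP [/eqP eu s]].
      by constructor 1; constructor 3; exists b, c.
    by subst u; constructor 4; exists b.
case=> [[[a av s]|[a [b [ab bv s]]]|[b [c [vb bc s]]]]|[uv s]|[uv [a au s]]|[b [vb bu s]]].
- by constructor 1; exists a => //; rewrite (subseq_rcons2 [:: a; v]) s.
- by constructor 2; exists a, b; split => //; rewrite (subseq_rcons2 [:: a; b]) s.
- by constructor 3; exists b, c; split => //; rewrite (subseq_rcons2 [:: v; b]) s.
- by constructor 1; exists u => //; rewrite (subseq_rcons2 [:: u; v]) eqxx s orbT.
- by constructor 2; exists a, u; split => //; rewrite (subseq_rcons2 [:: a; u]) eqxx s orbT.
- by constructor 3; exists b, u; split => //; rewrite (subseq_rcons2 [:: v; b]) eqxx s orbT.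
Qed.

(** A new occurrence must end at [v], and [bad] describes its first three letters. *)
Lemma all_avoids_rconsP x v :
  all (avoids (rcons x v)) patterns <-> all (avoids x) patterns /\ ~ bad x v.
Proof.
rewrite /patterns /= /avoids !andbT; split.
  case/and3P=> /containsP n1 /containsP n2 /containsP n3.
  split.
    apply/and3P; split; apply/containsP => -[w s e].
    - by apply: n1; exists w => //; apply: subseq_trans s (subseq_rcons _ _).
    - by apply: n2; exists w => //; apply: subseq_trans s (subseq_rcons _ _).
    - by apply: n3; exists w => //; apply: subseq_trans s (subseq_rcons _ _).
  case=> [[a av s]|[a [b [ab bv s]]]|[b [c [vb bc s]]]].
  - apply: n1; exists [:: a; v; a; v]; last by apply/red_0101P; exists a, v.
    by rewrite (subseq_rcons2 [:: a; v; a]) eqxx s orbT.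
  - apply: n2; exists [:: a; b; b; v]; last by apply/red_0112P; exists a, b, v.
    by rewrite (subseq_rcons2 [:: a; b; b]) eqxx s orbT.
  - apply: n3; exists [:: v; b; c; v]; last by apply/red_0120P; exists v, b, c.
    by rewrite (subseq_rcons2 [:: v; b; c]) eqxx s orbT.
case=> /and3P [/containsP n1 /containsP n2 /containsP n3] nb.
apply/and3P; split; apply/containsP => -[w s e].
- have [a [b [ab ew]]] := (red_0101P w).1 e; subst w.
  move: s; rewrite (subseq_rcons2 [:: a; b; a]) => /orP [s|/andP [/eqP ev s]].
    by apply: n1; exists [:: a; b; a; b].
  by subst v; apply: nb; constructor 1; exists a.
- have [a [b [c [ab bc ew]]]] := (red_0112P w).1 e; subst w.
  move: s; rewrite (subseq_rcons2 [:: a; b; b]) => /orP [s|/andP [/eqP ev s]].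
    by apply: n2; exists [:: a; b; b; c].
  by subst v; apply: nb; constructor 2; exists a, b.
- have [a [b [c [ab bc ew]]]] := (red_0120P w).1 e; subst w.
  move: s; rewrite (subseq_rcons2 [:: a; b; c]) => /orP [s|/andP [/eqP ev s]].
    by apply: n3; exists [:: a; b; c; a].
  by subst v; apply: nb; constructor 3; exists b, c.
Qed.

Lemma is_ascent_seqP x :
  reflect (head 1 x = 0 /\ forall i, 0 < i < size x -> nth 0 x i <= (asc (take i x)).+1)
          (is_ascent_seq x).
Proof.
apply: (iffP andP) => [[/eqP h /forallP f]|[h f]]; split=> //.
- by move=> i /andP [i0 ix]; apply: (implyP (f (Ordinal ix))).
- exact/eqP.
- by apply/forallP => i; apply/implyP => i0; apply: f; rewrite i0 ltn_ord.
Qed.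

Lemma is_ascent_seq_rcons x v : x != [::] ->
  is_ascent_seq (rcons x v) = is_ascent_seq x && (v <= (asc x).+1).
Proof.
move=> x0; have sx : 0 < size x by case: x x0.
have hd : head 1 (rcons x v) = head 1 x by case: x {sx} x0.
apply/is_ascent_seqP/andP => [[h f]|[/is_ascent_seqP [h f] lev]].
  split; last first.
    have := f (size x); rewrite size_rcons nth_rcons ltnn eqxx -cats1 take_size_cat //.
    by apply; rewrite sx /=.
  apply/is_ascent_seqP; split; first by rewrite -hd.
  move=> i /andP [i0 ix]; have := f i.
  rewrite size_rcons nth_rcons ix -cats1 takel_cat ?(ltnW ix) //.
  by apply; rewrite i0 ltnW.
split; first by rewrite hd.
move=> i; rewrite size_rcons ltnS => /andP [i0 ix].
rewrite nth_rcons -cats1 takel_cat //.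
case: ltngtP ix => // [ix _|-> _]; first by apply: f; rewrite i0.
by rewrite take_size.
Qed.

Lemma good_rconsP x v : x != [::] ->
  good (rcons x v) <-> [/\ good x, v <= (asc x).+1 & ~ bad x v].
Proof.
move=> x0; rewrite /good is_ascent_seq_rcons //; split.
  by case/andP=> /andP [-> ->] /all_avoids_rconsP [-> ?].
by case=> /andP [-> av] -> nb; apply/all_avoids_rconsP.
Qed.

Lemma good_catl x w : x != [::] -> good (x ++ w) -> good x.
Proof.
move=> x0; elim/last_ind: w => [|w v IH]; first by rewrite cats0.
rewrite -rcons_cat => /good_rconsP [|/IH //].
by case: x x0 {IH}.
Qed.

(** * Profiles and their change when a letter is appended *)

Lemma asc_rcons x u : x != [::] -> asc (rcons x u) = asc x + (last 0 x < u).
Proof.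
case: x => // a s _; elim: s a => [|b s IH] a; first by rewrite /= addn0.
by have := IH b; rewrite /= => ->; rewrite addnA.
Qed.

(* [k] is at once the maximum and the number of ascents of [x]. *)
Record profile (x : seq nat) (k : nat) (H : pred nat) : Prop := Profile {
  profile_good : good x;
  profile_asc : asc x = k;
  profile_mem : forall v, (v \in x) = (v <= k);
  profile_pairs : forall a b, a < b -> subseq [:: a; b] x = (b <= k);
  profile_bad : forall v, ~ bad x v <-> H v }.

Lemma profile_ext x k H H' : H =1 H' -> profile x k H -> profile x k H'.
Proof. by move=> e [? ? ? ? b]; split=> // v; rewrite -e. Qed.

Lemma profile_neq0 x k H : profile x k H -> x != [::].
Proof. by case=> /andP []; case: x. Qed.

Lemma profile_good_rcons x k H u : profile x k H ->
  good (rcons x u) = (u <= k.+1) && H u.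
Proof.
move=> p; have x0 := profile_neq0 p; case: p => gx ax _ _ bx.
apply/idP/andP; first by case/(good_rconsP _ x0)=> _; rewrite ax => -> /bx.
by case=> uk /bx nb; apply/good_rconsP; rewrite ?ax.
Qed.

(** A letter [u <= k] makes no ascent because it does not exceed the last letter; [u = k.+1] makes
    exactly one, so maximum and ascent number stay equal. The three excluded ranges come from 0101,
    0112 and 0120 in this order. *)
Lemma profile_rcons x k (H : pred nat) u :
    profile x k H -> u <= k.+1 -> (u <= k -> u <= last 0 x) -> H u ->
  profile (rcons x u) (maxn k u)
    (fun v => H v && ~~ [|| u < v <= k, (0 < u < v) && (u <= k) | (v.+1 < u) && (v < k)]).
Proof.
move=> p uk ul Hu; have x0 := profile_neq0 p.
have gu : good (rcons x u) by rewrite (profile_good_rcons _ p) uk.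
case: p => gx ax mx px bx; split=> //.
- rewrite asc_rcons // ax.
  have lk : last 0 x <= k by rewrite -mx; case: x x0 {gx ax mx px bx gu ul} => // a s _; apply: mem_last.
  by case: (leqP u k) => [/ul|]; lia.
- by move=> v; rewrite mem_rcons inE mx; lia.
- move=> a b ab; rewrite (subseq_rcons2 [:: a]) px // sub1seq mx; lia.
move=> v; rewrite bad_rcons; split.
  move=> nb; apply/andP; split; first by apply/bx => b; apply: nb; constructor 1.
  apply/negP => /or3P [/andP [uv vk]|/andP [/andP [u0 uv] u1]|/andP [vu vk]]; apply: nb.
  - by constructor 2; rewrite px.
  (* The smallest witnesses suffice: 0 below [u], and in the next case [v.+1] between [v] and
     [u]. *)
  - by constructor 3; split=> //; exists 0 => //; rewrite px.
  - by constructor 4; exists v.+1; rewrite px.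
case/andP=> /bx nb C [//|[uv]|[uv [a au]]|[b [vb bu]]]; rewrite px //; lia.
Qed.

(** * The generating tree: states, invariants, transitions *)

Inductive state := S0 | S1 | S11 | S10 | S102 | Up of nat | Top of nat | Const of nat.

Lemma state_comparable : comparable state.
Proof. by move=> s t; rewrite /decidable; decide equality; apply: PeanoNat.Nat.eq_dec. Qed.

HB.instance Definition _ := comparableMixin state_comparable.

(* [Up j] and [Top j] have maximum [j.+2]. *)
Definition inv (s : state) (x : seq nat) : Prop :=
  match s with
  | S0 => profile x 0 predT /\ last 0 x = 0
  | S1 => profile x 1 predT /\ last 0 x = 1
  | S11 => profile x 1 (fun v => v <= 1) /\ last 0 x = 1
  | S10 => profile x 1 (fun v => v != 1) /\ last 0 x = 0
  | S102 => profile x 2 (fun v => 1 < v) /\ last 0 x = 2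
  | Up j => profile x j.+2 (fun v => j < v) /\ last 0 x = j.+2
  | Top j => profile x j.+2 (fun v => j < v < j.+3) /\ last 0 x = j.+2
  | Const l => exists k (H : pred nat),
      [/\ profile x k H, last 0 x = l, l <= k & forall v, v <= k.+1 -> H v = (v == l)]
  end.

(** From [Up j], repeating the maximum bars larger letters (0112); falling to [j.+1] bars [j.+2]
    (0101) and [j.+3] (0112); rising bars [j.+1] (0120). [S102] differs from [Up 0] because its
    earlier descent to 0 bars the letter 1 (0101). *)
Definition trans (s : state) : seq (nat * state) :=
  match s with
  | S0 => [:: (0, S0); (1, S1)]
  | S1 => [:: (0, S10); (1, S11); (2, Up 0)]
  | S11 => [:: (0, Const 0); (1, S11)]
  | S10 => [:: (0, S10); (2, S102)]
  | S102 => [:: (2, Const 2); (3, Up 1)]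
  | Up j => [:: (j.+1, Const j.+1); (j.+2, Top j); (j.+3, Up j.+1)]
  | Top j => [:: (j.+1, Const j.+1); (j.+2, Top j)]
  | Const l => [:: (l, Const l)]
  end.

Lemma inv_neq0 s x : inv s x -> x != [::].
Proof.
by case: s => [|||||j|j|l] /=; try (by case=> /profile_neq0); case=> k [H [/profile_neq0]].
Qed.

Lemma inv_good s x : inv s x -> good x.
Proof. by case: s => [|||||j|j|l] /=; try (by case; case); case=> k [H [[]]]. Qed.

Lemma inv_good_rcons s x v : inv s x ->
  good (rcons x v) = (v \in [seq e.1 | e <- trans s]).
Proof.
case: s => [|||||j|j|l] /=; try (case=> p _; rewrite (profile_good_rcons _ p) !inE /=; lia).
case=> k [H [p _ lk Hl]]; rewrite (profile_good_rcons _ p) !inE.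
by case: (leqP v k.+1) => [/Hl -> //|]; lia.
Qed.

(** The predicate is compared only up to [k.+1], since the ascent bound excludes larger letters. *)
Lemma inv_const x k H l u : profile x k H -> u <= k -> u <= last 0 x -> H u -> l = u ->
    (forall v, v <= k.+1 -> v != u ->
      ~~ (H v && ~~ [|| u < v <= k, (0 < u < v) && (u <= k) | (v.+1 < u) && (v < k)])) ->
  inv (Const l) (rcons x u).
Proof.
move=> p uk ul Hu -> nH.
have := profile_rcons p (leqW uk) (fun _ => ul) Hu.
rewrite (maxn_idPl uk) => p'; do 2 eexists; split; first exact: p'.
- by rewrite last_rcons.
- exact: uk.
move=> v vk; case: (v =P u) => [->|/eqP vu]; last exact/negbTE/nH.
by rewrite Hu /=; lia.
Qed.

Lemma inv_rcons s x v s' : inv s x -> (v, s') \in trans s -> inv s' (rcons x v).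
Proof.
(* For targets other than [Const], a transition reduces to a pointwise identity between
   predicates. *)
have step k H k' H' u : profile x k H -> u <= k.+1 -> (u <= k -> u <= last 0 x) -> H u ->
    k' = maxn k u ->
    (forall w, H w && ~~ [|| u < w <= k, (0 < u < w) && (u <= k) | (w.+1 < u) && (w < k)] = H' w) ->
    profile (rcons x u) k' H' /\ last 0 (rcons x u) = u.
  move=> p uk ul Hu -> e; split; last by rewrite last_rcons.
  exact: profile_ext e (profile_rcons p uk ul Hu).
case: s => [|||||j|j|l] /=; rewrite !inE.
- case=> p e /orP [] /eqP [-> ->]; apply: (step _ _ _ _ _ p) => //= *; lia.
- case=> p e /or3P [] /eqP [-> ->]; apply: (step _ _ _ _ _ p) => //= *; lia.
- case=> p e /orP [] /eqP [-> ->]; last by apply: (step _ _ _ _ _ p) => //= *; lia.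
  by apply: (inv_const p) => //= *; lia.
- case=> p e /orP [] /eqP [-> ->]; apply: (step _ _ _ _ _ p) => //= *; lia.
- case=> p e /orP [] /eqP [-> ->]; last by apply: (step _ _ _ _ _ p) => //= *; lia.
  by apply: (inv_const p) => //= *; lia.
- case=> p e /or3P [] /eqP [-> ->]; try (by apply: (step _ _ _ _ _ p) => //= *; lia).
  by apply: (inv_const p) => //= *; lia.
- case=> p e /orP [] /eqP [-> ->]; last by apply: (step _ _ _ _ _ p) => //= *; lia.
  by apply: (inv_const p) => //= *; lia.
case=> k [H [p e lk Hl]] /eqP [-> ->].
apply: (inv_const p lk) => //; first by rewrite e.
  by rewrite Hl ?eqxx // leqW.
by move=> v' vk /negbTE nv; rewrite Hl // nv.
Qed.

(** * Words spelled by the paths of the tree *)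

Fixpoint words (s : state) (m : nat) : seq (seq nat) :=
  if m is m'.+1 then flatten [seq [seq e.1 :: w | w <- words e.2 m'] | e <- trans s]
  else [:: [::]].

Lemma words_size s m w : w \in words s m -> size w = m.
Proof.
elim: m s w => [|m IH] s w /=; first by rewrite inE => /eqP ->.
by case/flatten_mapP=> e _ /mapP [w' /IH <- ->].
Qed.

(** Goodness passes to nonempty prefixes, so a good continuation can be followed letter by letter,
    the state alone deciding which letters are allowed. *)
Lemma mem_words s m x w : inv s x -> size w = m -> good (x ++ w) = (w \in words s m).
Proof.
elim: m s x w => [|m IH] s x w.
  by move=> i /size0nil ->; rewrite cats0 (inv_good i).
case: w => // v w i [sw]; have x0 := inv_neq0 i.
have g := inv_good_rcons v i.
rewrite -cat_rcons /=; apply/idP/flatten_mapP => [gw|[[u s'] ein /mapP [w' w'in [ev ew]]]].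
  have : good (rcons x v) by apply: good_catl gw; case: x x0 {i g}.
  rewrite g => /mapP [[u s'] ein /= ev]; subst u; exists (v, s') => //=.
  by apply/map_f; rewrite -(IH _ _ _ (inv_rcons i ein)).
by subst v w; rewrite (IH _ _ _ (inv_rcons i ein)).
Qed.

(** Edges leaving a state carry distinct letters, so different paths spell different words. *)
Lemma words_uniq s m : uniq (words s m).
Proof.
elim: m s => [|m IH] s //=.
have : uniq [seq e.1 | e <- trans s] by case: s => [|||||j|j|l] //=; rewrite !inE; lia.
elim: (trans s) => //= e t IHt /andP [et ut].
rewrite cat_uniq IHt // andbT map_inj_uniq ?IH; last by move=> ? ? [].
apply/hasP => -[w /flatten_mapP [e' e't /mapP [w1 _ ->]] /mapP [w2 _ [ee _]]].
by move/negP: et; apply; rewrite -ee; apply: map_f.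
Qed.

(** * From ascent sequences to paths from the root *)

Lemma inv_zero : inv S0 [:: 0].
Proof.
have nb v : ~ bad [:: 0] v.
  case=> [[a _ /size_subseq]|[a [b [_ _ /size_subseq]]]|[b [c [_ _ /size_subseq]]]] //.
split=> //; split=> //.
- rewrite /good; apply/andP; split; first by apply/is_ascent_seqP; split=> // -[|[]].
  apply/allP => p pP; apply/negP => /containsP [w /size_subseq ws e].
  have : size p <= 1 by rewrite -e size_map.
  by move: pP; rewrite !inE => /or3P [] /eqP ->.
- by move=> v; rewrite inE; lia.
- by move=> a [|b] ab //=; case: (a == 0).
Qed.

Lemma asc_size x : asc x <= (size x).-1.
Proof.
elim: x => // a [|b s] IH //; move: IH; rewrite /=; lia.
Qed.

(** A prefix of length [i > 0] has at most [i.-1] ascents, so the entry after it is at most [i].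
    This makes [inord] lossless in [aP_words]. *)
Lemma is_ascent_seq_bound x v : is_ascent_seq x -> v \in x -> v < size x.
Proof.
case/is_ascent_seqP=> h f /(nthP 0) [i ix <-].
case: i ix => [|i] ix; first by case: x h ix {f} => //= a s ->.
apply: leq_ltn_trans (f i.+1 ix) _; apply: leq_ltn_trans (ix).
by have := asc_size (take i.+1 x); rewrite (size_takel (ltnW ix)).
Qed.

Lemma good_zero_words n x : (good x && (size x == n.+1)) = (x \in [seq 0 :: w | w <- words S0 n]).
Proof.
apply/andP/mapP => [[gx /eqP sx]|[w win ->]].
  case: x gx sx => // a w gx [sw].
  have a0 : a = 0 by case/andP: gx => /is_ascent_seqP [].
  by subst a; exists w; rewrite // -(mem_words inv_zero).
by rewrite (mem_words inv_zero (words_size win)) /= (words_size win) win.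
Qed.

(** The root [[:: 0]] already has length one, hence the shift. Both sides count duplicate-free lists
    with the same members. *)
Lemma aP_words n : aP patterns n.+1 = size (words S0 n).
Proof.
pose f (t : n.+1.-tuple 'I_n.+1) := map (@nat_of_ord n.+1) t.
have finj : injective f by move=> s t /(inj_map val_inj) /val_inj.
rewrite /aP cardE -(size_map f) -(size_map (cons 0) (words S0 n)).
apply: perm_size; apply: uniq_perm.
- by rewrite map_inj_uniq // enum_uniq.
- by rewrite map_inj_uniq ?words_uniq // => ? ? [].
move=> x; rewrite -good_zero_words; apply/mapP/andP => [[t]|[gx /eqP sx]].
  by rewrite mem_enum inE => gt ->; split; [exact: gt | rewrite size_map size_tuple].
have st : size [seq inord v : 'I_n.+1 | v <- x] == n.+1 by rewrite size_map sx.
have ft : x = f (Tuple st).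
  rewrite /f /= -map_comp -[LHS]map_id; apply/eq_in_map => v vx /=.
  by rewrite inordK // -sx; apply: is_ascent_seq_bound vx; case/andP: gx.
by exists (Tuple st); rewrite // mem_enum inE -/(f _) -ft.
Qed.

(** * Recurrences and closed forms for the level sizes *)

Lemma size_wordsS s m :
  size (words s m.+1) = sumn [seq size (words e.2 m) | e <- trans s].
Proof.
rewrite /= size_flatten /shape -map_comp; congr sumn; apply: eq_map => e /=.
by rewrite size_map.
Qed.

Lemma size_words_Const l m : size (words (Const l) m) = 1.
Proof. by elim: m => // m IH; rewrite size_wordsS /= IH. Qed.

Lemma size_words_Top j m : size (words (Top j) m) = m.+1.
Proof. by elim: m => // m IH; rewrite size_wordsS /= IH size_words_Const; lia. Qed.

Lemma size_words_S11 m : size (words S11 m) = m.+1.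
Proof. by elim: m => // m IH; rewrite size_wordsS /= IH size_words_Const; lia. Qed.

(** These are triangular numbers. The recurrence moves to [j.+1], so the induction is uniform in
    [j]. *)
Lemma size_words_Up j m : 2 * size (words (Up j) m) = m.+1 * m.+2.
Proof.
elim: m j => // m IH j; have := IH j.+1.
rewrite size_wordsS /= size_words_Const size_words_Top; lia.
Qed.

Lemma size_words_S102 m : 2 * size (words S102 m) = m ^ 2 + m + 2.
Proof.
case: m => // m; have := size_words_Up 1 m.
rewrite size_wordsS /= size_words_Const; lia.
Qed.

(** The loop at [S10] makes this a running sum of the counts for [S102]. *)
Lemma size_words_S10 m : 6 * size (words S10 m) = m ^ 3 + 5 * m + 6.
Proof.
elim: m => // m IH; have := size_words_S102 m.
rewrite size_wordsS /=; lia.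
Qed.

(** The formula starts at length one: extended to length zero, the cubic would give 0 instead of 1.
    This is why the final polynomial holds only from length two on. *)
Lemma size_words_S1 m : 6 * size (words S1 m.+1) = m ^ 3 + 3 * m ^ 2 + 20 * m + 18.
Proof.
have := size_words_S10 m; have := size_words_Up 0 m.
rewrite size_wordsS /= size_words_S11; lia.
Qed.

(** The quartic in [n = m.+2], with its negative terms moved to the left to stay within [nat]. *)
Lemma size_words_S0 m :
  24 * size (words S0 m.+1) + 6 * m.+2 ^ 3 + 114 * m.+2
  = m.+2 ^ 4 + 47 * m.+2 ^ 2 + 120.
Proof.
elim: m => // m IH; have := size_words_S1 m.
(* The sum is written out by hand because simplification would also unfold the words of length
   [m.+1]. *)
rewrite (size_wordsS S0 m.+1) -[sumn _]/(size (words S0 m.+1) + (size (words S1 m.+1) + 0)).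
lia.
Qed.

Local Open Scope ring_scope.

Theorem theorem4p1 :
  aP [:: [:: 0; 1; 0; 1]%N; [:: 0; 1; 1; 2]%N; [:: 0; 1; 2; 0]%N] 1 = 1%N /\
  forall n : nat, (2 <= n)%N ->
    (aP [:: [:: 0; 1; 0; 1]%N; [:: 0; 1; 1; 2]%N; [:: 0; 1; 2; 0]%N] n)%:R =
      ((n%:R ^+ 4 - 6 * n%:R ^+ 3 + 47 * n%:R ^+ 2 - 114 * n%:R + 120) / 24
        : rat).
Proof.
rewrite -/patterns; split; first exact: aP_words.
case=> [|[|m]] // _; rewrite aP_words.
have := size_words_S0 m; move: m.+2 (size _) => n c /(congr1 (fun k : nat => k%:R : rat)).
rewrite !(natrX, natrD, natrM) => e.
(* Over the common denominator 24 only the numerators remain; the terms moved to the left are added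
   and subtracted again. *)
have -> : c%:R = (24 * c%:R) / 24 :> rat by field.
by congr (_ / _); rewrite -[LHS](addrK (6 * n%:R ^+ 3 + 114 * n%:R)) addrA e; ring.
Qed.
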